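(* Let $I,J\subset\mathbb{R}$ be open intervals and let $u:I\to\mathbb{R}$, $v:J\to\mathbb{R}$ be smooth functions. Consider the translation surface of type 5 in the Heisenberg group $\mathrm{Nil}_3$, parametrized by $$r(x,y)=(v(y),y,0)*(x,0,u(x))=\Big(x+v(y),\,y,\,u(x)-\frac{xy}{2}\Big),\qquad (x,y)\in I\times J.$$ This surface is minimal if and only if one of the following holds: (i) there exist $u_0,a,b\in\mathbb{R}$ such that $u(x)=u_0$ for all $x\in I$ and $v(y)=\frac{a}{y}+b$ for all $y\in J$ with $y\neq0$; (ii) there exist $a,b,c,c_1\in\mathbb{R}$ such that $v(y)=ay+b$ for all $y\in J$ and $$u(x)=-\frac{ax^2+abx+c}{2(1+a^2)}+c_1\left(\frac{x}{2}+\frac{b}{4}\right)\sqrt{4(1+a^2)+(2x+b)^2}+c_1(1+a^2)\ln\left(2x+b+\sqrt{4(1+a^2)+(2x+b)^2}\right)$$ for all $x\in I$.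
   Context: The Heisenberg group $\mathrm{Nil}_3$ is $\mathbb{R}^3$ with the group operation $$(x,y,z)*(\overline{x},\overline{y},\overline{z})=\Big(x+\overline{x},\ y+\overline{y},\ z+\overline{z}+\frac{x\overline{y}}{2}-\frac{\overline{x}y}{2}\Big),$$ equipped with the left invariant Riemannian metric $$\tilde g=dx^2+dy^2+\Big(dz+\tfrac12(y\,dx-x\,dy)\Big)^2.$$ A translation surface in $\mathrm{Nil}_3$ is a surface parametrized as the $*$-product of two curves lying in coordinate planes of $\mathbb{R}^3$. It is of type 5 when it is $M(\gamma_2,\gamma_1)=\gamma_2(y)*\gamma_1(x)$ with $\gamma_1(x)=(x,0,u(x))$ and $\gamma_2(y)=(v(y),y,0)$, $u,v$ smooth. A surface immersed in $(\mathrm{Nil}_3,\tilde g)$ is minimal if its mean curvature $H=\frac12\mathrm{trace}(A)$ vanishes identically, where $A$ is the shape operator with respect to a unit normal and the metric $\tilde g$. *)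

(* Defs.v *)
From Stdlib Require Import Reals Lra Lia.
From Coquelicot Require Import Coquelicot.
Open Scope R_scope.

Definition Rbar_open_interval (a b : Rbar) (x : R) : Prop :=
  Rbar_lt a x /\ Rbar_lt x b.

(* A function on an open set [D] is represented by a total function; its
   derivatives at points of [D] do not depend on the values outside [D]. *)
Definition smooth_on (D : R -> Prop) (f : R -> R) : Prop :=
  forall (n : nat) (x : R), D x -> ex_derive_n f n x.

(** * Vectors and matrices in dimension 3 *)

Definition R3 : Type := (R * R * R)%type.

(* Indices range over 0, 1, 2; every larger index is read as 2. *)
Definition coord (k : nat) (p : R3) : R :=
  match k with
  | O => fst (fst p)
  | S O => snd (fst p)
  | _ => snd p
  end.

Definition basis (k : nat) : R3 :=
  match k with
  | O => (1, 0, 0)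
  | S O => (0, 1, 0)
  | _ => (0, 0, 1)
  end.

Definition sum3 (f : nat -> R) : R := f 0%nat + f 1%nat + f 2%nat.

Definition next3 (i : nat) : nat :=
  match i with
  | O => 1%nat
  | S O => 2%nat
  | _ => 0%nat
  end.

(* Taking the complementary rows and columns in cyclic order absorbs the sign
   (-1)^(i+j) of the cofactor. *)
Definition cofactor3 (m : nat -> nat -> R) (i j : nat) : R :=
  let i1 := next3 i in let i2 := next3 i1 in
  let j1 := next3 j in let j2 := next3 j1 in
  m i1 j1 * m i2 j2 - m i1 j2 * m i2 j1.

Definition det3 (m : nat -> nat -> R) : R :=
  sum3 (fun j => m 0%nat j * cofactor3 m 0 j).

Definition inv3 (m : nat -> nat -> R) (i j : nat) : R :=
  cofactor3 m j i / det3 m.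

Lemma inv3_right (m : nat -> nat -> R) (i j : nat) :
  det3 m <> 0 -> (i <= 2)%nat -> (j <= 2)%nat ->
  sum3 (fun k => m i k * inv3 m k j) = if Nat.eqb i j then 1 else 0.
Proof.
  intros Hd Hi Hj.
  destruct i as [|[|[|i]]]; try lia;
  destruct j as [|[|[|j]]]; try lia;
  unfold inv3, det3, sum3, cofactor3 in *; simpl in *;
  field; exact Hd.
Qed.

(** * Riemannian metrics on R^3 and their Levi-Civita connection *)

(* [g p v w] is the inner product at [p] of the tangent vectors [v] and [w]. *)
Definition metric : Type := R3 -> R3 -> R3 -> R.

Definition metric_coeff (g : metric) (p : R3) (i j : nat) : R :=
  g p (basis i) (basis j).

Definition partial (k : nat) (f : R3 -> R) (p : R3) : R :=
  Derive (fun h => f (plus p (scal h (basis k)))) 0.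

(* Gamma^k_ij *)
Definition christoffel (g : metric) (k i j : nat) (p : R3) : R :=
  / 2 * sum3 (fun l =>
    inv3 (metric_coeff g p) k l *
      (partial i (fun q => metric_coeff g q j l) p
       + partial j (fun q => metric_coeff g q i l) p
       - partial l (fun q => metric_coeff g q i j) p)).

Definition velocity (c : R -> R3) (t : R) : R3 :=
  (Derive (fun h => coord 0 (c h)) t,
   Derive (fun h => coord 1 (c h)) t,
   Derive (fun h => coord 2 (c h)) t).

(* Covariant derivative along the curve [c] of the vector field [V] along [c]. *)
Definition cov_deriv (g : metric) (c V : R -> R3) (t : R) : R3 :=
  let d (k : nat) :=
    Derive (fun h => coord k (V h)) t
    + sum3 (fun i => sum3 (fun j =>
        christoffel g k i j (c t) * coord i (velocity c t) * coord j (V t))) in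
  (d 0%nat, d 1%nat, d 2%nat).

(** * Parametrized surfaces *)

Section Surface.

Variables (g : metric) (D : R -> R -> Prop) (r : R -> R -> R3).

Definition tangent1 (s t : R) : R3 := velocity (fun s' => r s' t) s.
Definition tangent2 (s t : R) : R3 := velocity (fun t' => r s t') t.

Definition immersed : Prop :=
  forall s t, D s t -> forall a b : R,
    plus (scal a (tangent1 s t)) (scal b (tangent2 s t)) = zero ->
    a = 0 /\ b = 0.

(* The algebraic conditions determine [N] up to sign at each point, so on a
   rectangle the existence of the partial derivatives fixes the sign and makes
   [N] as regular as the tangent vectors. *)
Definition unit_normal (N : R -> R -> R3) : Prop :=
  forall s t, D s t ->
    g (r s t) (N s t) (tangent1 s t) = 0 /\
    g (r s t) (N s t) (tangent2 s t) = 0 /\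
    g (r s t) (N s t) (N s t) = 1 /\
    (forall k : nat, ex_derive (fun s' => coord k (N s' t)) s) /\
    (forall k : nat, ex_derive (fun t' => coord k (N s t')) t).

(* The shape operator [X |-> - nabla_X N] at the point of parameters [s], [t]
   has matrix [[a11, a12], [a21, a22]] in the basis of coordinate tangent
   vectors. *)
Definition shape_operator (N : R -> R -> R3) (s t a11 a12 a21 a22 : R) : Prop :=
  opp (cov_deriv g (fun s' => r s' t) (fun s' => N s' t) s)
    = plus (scal a11 (tangent1 s t)) (scal a21 (tangent2 s t)) /\
  opp (cov_deriv g (fun t' => r s t') (fun t' => N s t') t)
    = plus (scal a12 (tangent1 s t)) (scal a22 (tangent2 s t)).

Definition mean_curvature (N : R -> R -> R3) (s t H : R) : Prop :=
  exists a11 a12 a21 a22 : R,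
    shape_operator N s t a11 a12 a21 a22 /\ H = / 2 * (a11 + a22).

Definition minimal : Prop :=
  immersed /\
  exists N : R -> R -> R3,
    unit_normal N /\ forall s t, D s t -> mean_curvature N s t 0.

End Surface.

(** * The Heisenberg group *)

Definition nil_mul (p q : R3) : R3 :=
  match p, q with
  | (x, y, z), (x', y', z') =>
      (x + x', y + y', z + z' + x * y' / 2 - x' * y / 2)
  end.

Definition nil_form (p w : R3) : R :=
  coord 2 w + / 2 * (coord 1 p * coord 0 w - coord 0 p * coord 1 w).

(* dx^2 + dy^2 + (dz + (y dx - x dy) / 2)^2 *)
Definition nil_metric : metric := fun p w w' =>
  coord 0 w * coord 0 w' + coord 1 w * coord 1 w' + nil_form p w * nil_form p w'.

Definition translation_surface5 (u v : R -> R) (x y : R) : R3 :=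
  nil_mul (v y, y, 0) (x, 0, u x).

Lemma translation_surface5E (u v : R -> R) (x y : R) :
  translation_surface5 u v x y = (x + v y, y, u x - x * y / 2).
Proof.
  unfold translation_surface5, nil_mul.
  f_equal; [f_equal|]; field.
Qed.

(* Main.v *)
Require Import Defs.
From Stdlib Require Import Reals Lra Lia Classical.
From Coquelicot Require Import Coquelicot.
Open Scope R_scope.

(* In the left invariant frame the surface has tangent vectors [(1, 0, u')] and [(v', 1, q)]
   with [q = (y v' - v)/2 - x], hence normal [(- u', u' v' - q, 1)], and [H = 0] becomes
     [(1 + v'^2 + q^2) u'' + (1 + u'^2) (y/2 - u') v'' + v' + u' q = 0].
   If [v'' = 0] this is a linear equation for [u'], whose solutions are (ii).  Suppose now that
   [v''] and [u''] are both nonzero somewhere.  Differentiating in [y], dividing by [v''], and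
   differentiating twice more gives a relation of the shape
   [u'' k(y) + (1 + u'^2) (l(y) + m(y) u') = 0]; since [k] cannot vanish identically,
   [u'' = (1 + u'^2) (alpha + beta u')] with constants [alpha], [beta].  Substituting this in
   an earlier relation and eliminating [x] leaves a polynomial in [u'] that must vanish
   identically, which forces [alpha = beta = 0].  So [v''] not identically zero implies that
   [u'] is constant; then [u' = 0] and [y v'' + 2 v' = 0], that is [(y v)'' = 0], which is (i). *)

(** * The Levi-Civita connection of the Heisenberg group *)

(* Only the form [theta = dz + (y dx - x dy)/2] varies with the point. *)
Definition nil_metric_partial (i j l : nat) (p : R3) : R :=
  let theta k := nil_form p (basis k) in
  let dtheta k := match i, k with
    | O, S O => - / 2 | S O, O => / 2 | _, _ => 0 end in
  dtheta j * theta l + theta j * dtheta l.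

Lemma partial_nil_metric (i j l : nat) (p : R3) :
  (i < 3)%nat -> (j < 3)%nat -> (l < 3)%nat ->
  partial i (fun q => metric_coeff nil_metric q j l) p = nil_metric_partial i j l p.
Proof.
  intros Hi Hj Hl; destruct p as [[X Y] Z].
  apply is_derive_unique.
  destruct i as [|[|[|i]]]; try lia; destruct j as [|[|[|j]]]; try lia;
    destruct l as [|[|[|l]]]; try lia;
    unfold metric_coeff, nil_metric, nil_metric_partial, nil_form; simpl;
    unfold plus, scal; simpl; unfold mult; simpl;
    auto_derive; trivial; field.
Qed.

(** The coframe [dx, dy, theta] is orthonormal and [theta] differs from [dz] only by multiples of
    [dx] and [dy], so the volume form is [dx dy dz]. *)
Lemma det3_nil_metric (p : R3) : det3 (metric_coeff nil_metric p) = 1.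
Proof.
  destruct p as [[X Y] Z].
  unfold det3, sum3, cofactor3, metric_coeff, nil_metric, nil_form; simpl; field.
Qed.

(* In the left invariant frame [E1 = d_x - (y/2) d_z], [E2 = d_y + (x/2) d_z], [E3 = d_z]
   the connection is constant: [D_E1 E2 = - D_E2 E1 = E3/2],
   [D_E1 E3 = D_E3 E1 = - E2/2], [D_E2 E3 = D_E3 E2 = E1/2]. *)
Lemma nil_cov_deriv (c V : R -> R3) (t : R) :
  let c' k := Derive (fun h => coord k (c h)) t in
  let V' k := Derive (fun h => coord k (V h)) t in
  let om := nil_form (c t) (velocity c t) in
  let ph := nil_form (c t) (V t) in
  let W := cov_deriv nil_metric c V t in
  coord 0 W = V' 0%nat + / 2 * (om * coord 1 (V t) + ph * c' 1%nat) /\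
  coord 1 W = V' 1%nat - / 2 * (c' 0%nat * ph + om * coord 0 (V t)) /\
  nil_form (c t) W =
    V' 2%nat + / 2 * (c' 1%nat * coord 0 (V t) + coord 1 (c t) * V' 0%nat
                      - c' 0%nat * coord 1 (V t) - coord 0 (c t) * V' 1%nat)
    + / 2 * (c' 0%nat * coord 1 (V t) - c' 1%nat * coord 0 (V t)).
Proof.
  intros c' V' om ph W.
  unfold W, cov_deriv, christoffel, sum3, inv3, velocity in *.
  fold (c' 0%nat) (c' 1%nat) (c' 2%nat) (V' 0%nat) (V' 1%nat) (V' 2%nat).
  rewrite !det3_nil_metric, !partial_nil_metric by lia.
  unfold om, ph, velocity; clear W om ph.
  fold (c' 0%nat) (c' 1%nat) (c' 2%nat).
  generalize (c' 0%nat) (c' 1%nat) (c' 2%nat) (V' 0%nat) (V' 1%nat) (V' 2%nat); clear c' V'.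
  intros c0 c1 c2 d0 d1 d2.
  destruct (c t) as [[X Y] Z]; destruct (V t) as [[V0 V1] V2].
  unfold cofactor3, nil_metric_partial, metric_coeff, nil_metric, nil_form; simpl.
  repeat split; field.
Qed.

(** The device by which every identity on an open set is differentiated below: the new identity
    [l = 0] is read off from the computed derivative of the old one. *)
Lemma is_derive_zero_on_open (U : R -> Prop) (f : R -> R) (x l : R) :
  open U -> U x -> (forall t, U t -> f t = 0) -> is_derive f x l -> l = 0.
Proof.
  intros HU Hx Hf Hl.
  rewrite <- (is_derive_unique _ _ _ Hl).
  apply is_derive_unique, is_derive_ext_loc with (fun _ => 0).
  - generalize (HU x Hx); apply filter_imp; intros t Ht; symmetry; auto.
  - apply (is_derive_const (V := R_NormedModule)).
Qed.

(** * Tangent vectors and shape operator of a type 5 surface *)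

Lemma translation_surface5_tangent1 (u v : R -> R) (x y p : R) :
  is_derive u x p ->
  tangent1 (translation_surface5 u v) x y = (1, 0, p - y / 2).
Proof.
  intros Hu; unfold tangent1, velocity, translation_surface5, nil_mul; simpl.
  f_equal; [f_equal|]; apply is_derive_unique; auto_derive; trivial; try field.
  - now exists p.
  - replace (Derive _ x) with p by (symmetry; now apply is_derive_unique); field.
Qed.

Lemma translation_surface5_tangent2 (u v : R -> R) (x y w : R) :
  is_derive v y w ->
  tangent2 (translation_surface5 u v) x y = (w, 1, - x / 2).
Proof.
  intros Hv; unfold tangent2, velocity, translation_surface5, nil_mul; simpl.
  f_equal; [f_equal|]; apply is_derive_unique; auto_derive; trivial; try field.
  - now exists w.
  - replace (Derive _ y) with w by (symmetry; now apply is_derive_unique); field.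
  - now exists w.
Qed.

(** [dx], [dy] and [theta] form a coframe at [p]. Comparing vectors through it replaces coordinates
    by components in the left invariant frame. *)
Lemma nil_vector_eq (p w w' : R3) :
  w = w' <->
  coord 0 w = coord 0 w' /\ coord 1 w = coord 1 w' /\ nil_form p w = nil_form p w'.
Proof.
  destruct p as [[X Y] Z], w as [[a b] c], w' as [[a' b'] c'].
  unfold nil_form; simpl; split.
  - intros E; injection E; intros; subst; auto.
  - intros (-> & -> & E); f_equal; lra.
Qed.

Lemma coord_lin2 (k : nat) (a b : R) (p q : R3) :
  coord k (plus (scal a p) (scal b q)) = a * coord k p + b * coord k q.
Proof.
  destruct p as [[? ?] ?], q as [[? ?] ?], k as [|[|k]]; reflexivity.
Qed.

Lemma coord_opp (k : nat) (p : R3) : coord k (opp p) = - coord k p.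
Proof. destruct p as [[? ?] ?], k as [|[|k]]; reflexivity. Qed.

Lemma nil_form_lin2 (c : R3) (a b : R) (p q : R3) :
  nil_form c (plus (scal a p) (scal b q)) = a * nil_form c p + b * nil_form c q.
Proof. unfold nil_form; rewrite !coord_lin2; ring. Qed.

Lemma nil_form_opp (c p : R3) : nil_form c (opp p) = - nil_form c p.
Proof. unfold nil_form; rewrite !coord_opp; ring. Qed.

(** The shape operator read in the left invariant frame, where the tangent vectors are [(1, 0, p)]
    and [(w, 1, q)] and the normal is [(n1, n2, n3)]. The numbers [n3x] and [n3y] are the parameter
    derivatives of [n3]; the other halved terms come from the connection. *)
Lemma shape_operator5 (u v : R -> R) (N : R -> R -> R3) (x y p w : R)
  (A B : nat -> R) (a11 a12 a21 a22 : R) :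
  is_derive u x p -> is_derive v y w ->
  (forall k, is_derive (fun s => coord k (N s y)) x (A k)) ->
  (forall k, is_derive (fun t => coord k (N x t)) y (B k)) ->
  let n1 := coord 0 (N x y) in
  let n2 := coord 1 (N x y) in
  let n3 := nil_form (translation_surface5 u v x y) (N x y) in
  let q := (y * w - v y) / 2 - x in
  let n3x := A 2%nat + (y * A 0%nat - n2 - (x + v y) * A 1%nat) / 2 in
  let n3y := B 2%nat + (n1 + y * B 0%nat - w * n2 - (x + v y) * B 1%nat) / 2 in
  shape_operator nil_metric (translation_surface5 u v) N x y a11 a12 a21 a22 <->
  (- (A 0%nat + p * n2 / 2) = a11 + a21 * w /\
   - (A 1%nat - (n3 + p * n1) / 2) = a21 /\
   - (n3x + n2 / 2) = a11 * p + a21 * q) /\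
  (- (B 0%nat + (q * n2 + n3) / 2) = a12 + a22 * w /\
   - (B 1%nat - (w * n3 + q * n1) / 2) = a22 /\
   - (n3y + (w * n2 - n1) / 2) = a12 * p + a22 * q).
Proof.
  intros Hu Hv HA HB n1 n2 n3 q n3x n3y.
  unfold shape_operator.
  rewrite (translation_surface5_tangent1 u v x y p Hu).
  rewrite (translation_surface5_tangent2 u v x y w Hv).
  rewrite !(nil_vector_eq (translation_surface5 u v x y)).
  rewrite !coord_lin2, !nil_form_lin2, !coord_opp, !nil_form_opp.
  destruct (nil_cov_deriv (fun s => translation_surface5 u v s y) (fun s => N s y) x)
    as (C0 & C1 & C2).
  destruct (nil_cov_deriv (fun t => translation_surface5 u v x t) (fun t => N x t) y)
    as (D0 & D1 & D2).
  rewrite C0, C1, C2, D0, D1, D2; clear C0 C1 C2 D0 D1 D2.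
  fold (tangent1 (translation_surface5 u v) x y) (tangent2 (translation_surface5 u v) x y).
  assert (E1 := translation_surface5_tangent1 u v x y p Hu).
  assert (E2 := translation_surface5_tangent2 u v x y w Hv).
  assert (F0 := f_equal (coord 0) E1); assert (F1 := f_equal (coord 1) E1).
  assert (G0 := f_equal (coord 0) E2); assert (G1 := f_equal (coord 1) E2).
  unfold tangent1, tangent2, velocity in F0, F1, G0, G1.
  cbn [coord fst snd] in F0, F1, G0, G1.
  change (velocity (fun s : R => translation_surface5 u v s y) x)
    with (tangent1 (translation_surface5 u v) x y).
  change (velocity (fun t : R => translation_surface5 u v x t) y)
    with (tangent2 (translation_surface5 u v) x y).
  rewrite E1, E2.
  cbn [coord].
  rewrite F0, F1, G0, G1.
  assert (DA : forall k, Derive (fun s : R => coord k (N s y)) x = A k)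
    by (intros k; exact (is_derive_unique _ _ _ (HA k))).
  assert (DB : forall k, Derive (fun t : R => coord k (N x t)) y = B k)
    by (intros k; exact (is_derive_unique _ _ _ (HB k))).
  assert (DA0 := DA 0%nat); assert (DA1 := DA 1%nat); assert (DA2 := DA 2%nat).
  assert (DB0 := DB 0%nat); assert (DB1 := DB 1%nat); assert (DB2 := DB 2%nat).
  cbn [coord] in DA0, DA1, DA2, DB0, DB1, DB2.
  rewrite DA0, DA1, DA2, DB0, DB1, DB2.
  unfold n3x, n3y, q, n1, n2; clear n1 n2 n3x n3y q.
  fold n3; clearbody n3.
  unfold nil_form; rewrite !translation_surface5E.
  clear; destruct (N x y) as [[m1 m2] m3]; cbn [coord fst snd].
  generalize (A 0%nat) (A 1%nat) (A 2%nat) (B 0%nat) (B 1%nat) (B 2%nat) (v y).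
  intros.
  split; intros ((? & ? & ?) & (? & ? & ?)); repeat split; nra.
Qed.

(** * The minimal surface equation *)

Definition minimal_eq5 (x y p p' v v' v'' : R) : Prop :=
  let q := (y * v' - v) / 2 - x in
  (1 + v' ^ 2 + q ^ 2) * p' + (1 + p ^ 2) * (y / 2 - p) * v'' + v' + p * q = 0.

(** The given normal is only known to be a multiple [e] of [(- u', u' v' - q, 1)]. Its derivatives
    follow from the orthogonality relations, and the trace condition becomes [e] times the
    equation. *)
Lemma minimal_eq5_of_minimal (I J : R -> Prop) (u u' u'' v v' v'' : R -> R) :
  open I -> open J ->
  (forall x, I x -> is_derive u x (u' x)) -> (forall x, I x -> is_derive u' x (u'' x)) ->
  (forall y, J y -> is_derive v y (v' y)) -> (forall y, J y -> is_derive v' y (v'' y)) ->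
  minimal nil_metric (fun x y => I x /\ J y) (translation_surface5 u v) ->
  forall x y, I x -> J y -> minimal_eq5 x y (u' x) (u'' x) (v y) (v' y) (v'' y).
Proof.
  intros HI HJ Hu Hu' Hv Hv' [_ [N [HN Hmin]]] x y Hx Hy.
  set (a s t := coord 0 (N s t)); set (b s t := coord 1 (N s t)).
  set (c s t := coord 2 (N s t)).
  (* [e] is [theta] applied to [N], the third frame component of the normal. *)
  set (e s t := c s t + / 2 * (t * a s t - (s + v t) * b s t)).
  assert (He : forall s t, nil_form (translation_surface5 u v s t) (N s t) = e s t)
    by (intros s t; unfold nil_form; rewrite translation_surface5E; reflexivity).
  set (q s t := (t * v' t - v t) / 2 - s).
  (* The two orthogonality relations are kept in the form of a vanishing expression, ready to be
     differentiated in [s] and in [t]. *)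
  assert (Ha : forall s t, I s -> J t -> a s t + u' s * e s t = 0).
  { intros s t Hs Ht; destruct (HN s t (conj Hs Ht)) as (H & _).
    rewrite (translation_surface5_tangent1 u v s t (u' s)) in H by auto.
    unfold nil_metric in H; rewrite He in H.
    unfold nil_form in H; rewrite translation_surface5E in H; simpl in H.
    rewrite <- H; unfold a; simpl; field. }
  assert (Hb : forall s t, I s -> J t -> b s t - (u' s * v' t - q s t) * e s t = 0).
  { intros s t Hs Ht; destruct (HN s t (conj Hs Ht)) as (_ & H & _).
    rewrite (translation_surface5_tangent2 u v s t (v' t)) in H by auto.
    unfold nil_metric in H; rewrite He in H.
    unfold nil_form in H; rewrite translation_surface5E in H; simpl in H.
    assert (H' : b s t = - a s t * v' t - q s t * e s t)
      by (apply Rminus_diag_uniq; rewrite <- H; unfold a, b, q; simpl; field).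
    specialize (Ha s t Hs Ht); rewrite H'.
    replace (a s t) with (- u' s * e s t) by lra; ring. }
  (* If [e] vanished, so would the other two frame components, against unit length. *)
  assert (Hne : e x y <> 0).
  { intros E; destruct (HN x y (conj Hx Hy)) as (_ & _ & H & _).
    unfold nil_metric in H; rewrite He in H.
    fold (a x y) (b x y) in H.
    specialize (Ha x y Hx Hy); specialize (Hb x y Hx Hy); rewrite E in *.
    replace (a x y) with 0 in H by lra; replace (b x y) with 0 in H by lra; lra. }
  destruct (HN x y (conj Hx Hy)) as (_ & _ & _ & Dx & Dy).
  destruct (Hmin x y (conj Hx Hy)) as (a11 & a12 & a21 & a22 & HA & Htr).
  assert (Dax : ex_derive (fun s : R => a s y) x) by exact (Dx 0%nat).
  assert (Dbx : ex_derive (fun s : R => b s y) x) by exact (Dx 1%nat).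
  assert (Dcx : ex_derive (fun s : R => c s y) x) by exact (Dx 2%nat).
  assert (Day : ex_derive (fun t : R => a x t) y) by exact (Dy 0%nat).
  assert (Dby : ex_derive (fun t : R => b x t) y) by exact (Dy 1%nat).
  assert (Dcy : ex_derive (fun t : R => c x t) y) by exact (Dy 2%nat).
  rewrite (shape_operator5 u v N x y (u' x) (v' y)
    (fun k => Derive (fun s : R => coord k (N s y)) x)
    (fun k => Derive (fun t : R => coord k (N x t)) y)) in HA;
    [| auto | auto | intros k; apply Derive_correct, Dx
     | intros k; apply Derive_correct, Dy].
  rewrite He in HA; fold (a x y) (b x y) (q x y) in HA.
  change (Derive (fun s : R => coord 0 (N s y)) x) with (Derive (fun s : R => a s y) x) in HA.
  change (Derive (fun s : R => coord 1 (N s y)) x) with (Derive (fun s : R => b s y) x) in HA.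
  change (Derive (fun s : R => coord 2 (N s y)) x) with (Derive (fun s : R => c s y) x) in HA.
  change (Derive (fun t : R => coord 0 (N x t)) y) with (Derive (fun t : R => a x t) y) in HA.
  change (Derive (fun t : R => coord 1 (N x t)) y) with (Derive (fun t : R => b x t) y) in HA.
  change (Derive (fun t : R => coord 2 (N x t)) y) with (Derive (fun t : R => c x t) y) in HA.
  set (ax := Derive (fun s : R => a s y) x) in *.
  set (bx := Derive (fun s : R => b s y) x) in *.
  set (cx := Derive (fun s : R => c s y) x) in *.
  set (ay := Derive (fun t : R => a x t) y) in *.
  set (bt := Derive (fun t : R => b x t) y) in *.
  set (cy := Derive (fun t : R => c x t) y) in *.
  set (ex := cx + (y * ax - b x y - (x + v y) * bx) / 2) in *.
  set (ey := cy + (a x y + y * ay - v' y * b x y - (x + v y) * bt) / 2) in *.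
  assert (Hex : is_derive (fun s : R => e s y) x ex).
  { unfold e; auto_derive; [tauto|]. fold ax bx cx; unfold ex; field. }
  assert (Hey : is_derive (fun t : R => e x t) y ey).
  { unfold e; auto_derive; [repeat split; auto; now exists (v' y); auto|].
    rewrite (is_derive_unique (fun t : R => v t) _ _ (Hv y Hy)).
    fold ay bt cy; unfold ey; field. }
  (* [Ha] and [Hb] differentiated in both parameters. *)
  assert (Gax : ax + u'' x * e x y + u' x * ex = 0).
  { apply (is_derive_zero_on_open I (fun s => a s y + u' s * e s y) x); auto.
    auto_derive.
    - repeat split; auto; solve [exists (u'' x); auto | now exists ex].
    - rewrite (is_derive_unique (fun t : R => u' t) _ _ (Hu' x Hx)), (is_derive_unique _ _ _ Hex).
      fold ax; ring. }
  assert (Gbx : bx - (u'' x * v' y + 1) * e x y - (u' x * v' y - q x y) * ex = 0).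
  { apply (is_derive_zero_on_open I (fun s => b s y - (u' s * v' y - q s y) * e s y) x); auto.
    unfold q; auto_derive.
    - repeat split; auto; solve [exists (u'' x); auto | now exists ex].
    - rewrite (is_derive_unique (fun t : R => u' t) _ _ (Hu' x Hx)), (is_derive_unique _ _ _ Hex).
      fold bx; ring. }
  assert (Gby : bt - (u' x * v'' y - y * v'' y / 2) * e x y - (u' x * v' y - q x y) * ey = 0).
  { apply (is_derive_zero_on_open J (fun t => b x t - (u' x * v' t - q x t) * e x t) y); auto.
    unfold q; auto_derive.
    - repeat split; auto; 
        solve [exists (v'' y); auto | exists (v' y); auto | exists ey; auto].
    - rewrite (is_derive_unique (fun t : R => v t) _ _ (Hv y Hy)),
        (is_derive_unique (fun t : R => v' t) _ _ (Hv' y Hy)),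
        (is_derive_unique _ _ _ Hey).
      fold bt; field. }
  assert (Gay : ay + u' x * ey = 0).
  { apply (is_derive_zero_on_open J (fun t => a x t + u' x * e x t) y); auto.
    auto_derive.
    - repeat split; auto; now exists ey.
    - rewrite (is_derive_unique _ _ _ Hey).
      fold ay; ring. }
  specialize (Ha x y Hx Hy); specialize (Hb x y Hx Hy).
  clearbody ax bx ay bt ex ey.
  destruct HA as ((A1 & A2 & A3) & (B1 & B2 & B3)).
  unfold minimal_eq5; fold (q x y).
  apply Rmult_eq_reg_l with (e x y); [|exact Hne].
  rewrite Rmult_0_r.
  (* From here on it is algebra at one point. The derivatives [ex] and [ey] multiply the normal
     direction, so they cancel in the pairings with the tangent vectors. *)
  revert A1 A2 A3 B1 B2 B3 Gax Gbx Gay Gby Ha Hb.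
  generalize (e x y) (q x y) (a x y) (b x y) (u' x) (u'' x) (v' y) (v'' y).
  clear - Htr; intros e q n1 n2 p p' w w' A1 A2 A3 B1 B2 B3 Gax Gbx Gay Gby Ha Hb.
  assert (E1 : n1 = - p * e) by lra.
  assert (E2 : n2 = (p * w - q) * e) by lra.
  assert (E3 : ax = - (p' * e + p * ex)) by lra.
  assert (E4 : bx = (p' * w + 1) * e + (p * w - q) * ex) by lra.
  assert (E5 : ay = - p * ey) by lra.
  assert (E6 : bt = (p * w' - y * w' / 2) * e + (p * w - q) * ey) by lra.
  assert (E7 : a22 = - a11) by lra.
  clear Ha Hb Gax Gbx Gay Gby Htr.
  rewrite E7 in B1, B2, B3.
  subst n1 n2 ax bx ay bt.
  (* With [E, F, G] and [L, M, M', N] the two fundamental forms (the latter divided by [e]),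
     [G L - F M - F M' + E N] is the trace times [E G - F^2]. *)
  assert (HL : a11 * (1 + p ^ 2) + a21 * (w + p * q) = (p' - p * (p * w - q)) * e).
  { transitivity ((a11 + a21 * w) + p * (a11 * p + a21 * q)); [ring|].
    rewrite <- A1, <- A3; field. }
  assert (HM : a11 * (w + p * q) + a21 * (1 + w ^ 2 + q ^ 2)
               = - / 2 * (1 + p ^ 2 + (p * w + q) * (p * w - q)) * e).
  { transitivity (w * (a11 + a21 * w) + a21 + q * (a11 * p + a21 * q)); [ring|].
    rewrite <- A1, <- A3, <- A2; field. }
  assert (HM' : a12 * (1 + p ^ 2) - a11 * (w + p * q)
                = - / 2 * (1 + p ^ 2 + (p * w + q) * (p * w - q)) * e).
  { transitivity ((a12 + - a11 * w) + p * (a12 * p + - a11 * q)); [ring|].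
    rewrite <- B1, <- B3; field. }
  assert (HN : a12 * (w + p * q) - a11 * (1 + w ^ 2 + q ^ 2)
               = (- p * (w' + q) - w * q * (p * w - q) + y * w' / 2) * e).
  { transitivity (w * (a12 + - a11 * w) + - a11 + q * (a12 * p + - a11 * q)); [ring|].
    rewrite <- B1, <- B3, <- B2; field. }
  transitivity
    ((1 + w ^ 2 + q ^ 2) * ((p' - p * (p * w - q)) * e)
     - (w + p * q) * (- / 2 * (1 + p ^ 2 + (p * w + q) * (p * w - q)) * e)
     - (w + p * q) * (- / 2 * (1 + p ^ 2 + (p * w + q) * (p * w - q)) * e)
     + (1 + p ^ 2) * ((- p * (w' + q) - w * q * (p * w - q) + y * w' / 2) * e)); [field|].
  rewrite <- HL, <- HN; rewrite <- HM at 1; rewrite <- HM'; ring.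
Qed.

Lemma is_derive_inv_sqrt (W : R -> R) (x l : R) :
  is_derive W x l -> 0 < W x ->
  is_derive (fun s : R => / sqrt (W s)) x (- l / (2 * W x) * / sqrt (W x)).
Proof.
  intros HW Hp.
  assert (Hs := sqrt_lt_R0 _ Hp).
  assert (E := sqrt_sqrt _ (Rlt_le _ _ Hp)).
  auto_derive.
  - repeat split; try lra; now exists l.
  - rewrite (is_derive_unique (fun s : R => W s) _ _ HW).
    set (S := sqrt (W x)) in *; clearbody S; rewrite <- E; field; lra.
Qed.

(** The vector [(- u', u' v' - q, 1)] is normalized explicitly, and the matrix of the shape operator
    is computed from its derivatives. *)
Lemma minimal_of_minimal_eq5 (I J : R -> Prop) (u u' u'' v v' v'' : R -> R) :
  (forall x, I x -> is_derive u x (u' x)) -> (forall x, I x -> is_derive u' x (u'' x)) ->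
  (forall y, J y -> is_derive v y (v' y)) -> (forall y, J y -> is_derive v' y (v'' y)) ->
  (forall x y, I x -> J y -> minimal_eq5 x y (u' x) (u'' x) (v y) (v' y) (v'' y)) ->
  minimal nil_metric (fun x y => I x /\ J y) (translation_surface5 u v).
Proof.
  intros Hu Hu' Hv Hv' Heq; split.
  { intros s t [Hs Ht] a b H.
    rewrite (translation_surface5_tangent1 u v s t (u' s)) in H by auto.
    rewrite (translation_surface5_tangent2 u v s t (v' t)) in H by auto.
    assert (H0 := f_equal (coord 0) H); assert (H1 := f_equal (coord 1) H).
    rewrite coord_lin2 in H0, H1; simpl in H0, H1.
    change zero with 0 in H0, H1.
    assert (b = 0) by lra; subst b; split; lra. }
  set (q s t := (t * v' t - v t) / 2 - s).
  (* [W] is the squared length of the unnormalized normal; it also equals [E G - F^2] for the first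
     fundamental form. *)
  set (W s t := 1 + u' s ^ 2 + (u' s * v' t - q s t) ^ 2).
  assert (HW : forall s t, 0 < W s t).
  { intros s t; unfold W.
    assert (H1 := pow2_ge_0 (u' s)); assert (H2 := pow2_ge_0 (u' s * v' t - q s t)); lra. }
  set (e s t := / sqrt (W s t)).
  set (a s t := - u' s * e s t).
  set (b s t := (u' s * v' t - q s t) * e s t).
  (* Chosen so that [theta] takes the value [e] on [(a, b, c)]. *)
  set (c s t := e s t - / 2 * (t * a s t - (s + v t) * b s t)).
  set (Wx s t := 2 * u' s * u'' s + 2 * (u' s * v' t - q s t) * (u'' s * v' t + 1)).
  set (Wy s t := 2 * (u' s * v' t - q s t) * (u' s * v'' t - t * v'' t / 2)).
  set (ex s t := - Wx s t / (2 * W s t) * e s t).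
  set (ey s t := - Wy s t / (2 * W s t) * e s t).
  set (ax s t := - u'' s * e s t - u' s * ex s t).
  set (bx s t := (u'' s * v' t + 1) * e s t + (u' s * v' t - q s t) * ex s t).
  set (cx s t := ex s t - / 2 * (t * ax s t - b s t - (s + v t) * bx s t)).
  set (ay s t := - u' s * ey s t).
  set (bt s t := (u' s * v'' t - t * v'' t / 2) * e s t + (u' s * v' t - q s t) * ey s t).
  set (cy s t := ey s t - / 2 * (a s t + t * ay s t - v' t * b s t - (s + v t) * bt s t)).
  assert (Dex : forall s t, I s -> is_derive (fun s : R => e s t) s (ex s t)).
  { intros s t Hs; apply (is_derive_inv_sqrt (fun s => W s t)); [|apply HW].
    unfold W, Wx, q; auto_derive; [repeat split; now exists (u'' s); auto|].
    rewrite (is_derive_unique (fun s : R => u' s) _ _ (Hu' s Hs)); field. }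
  assert (Dey : forall s t, J t -> is_derive (fun t : R => e s t) t (ey s t)).
  { intros s t Ht; apply (is_derive_inv_sqrt (fun t => W s t)); [|apply HW].
    unfold W, Wy, q; auto_derive.
    - repeat split; solve [exists (v' t); auto | exists (v'' t); auto].
    - rewrite (is_derive_unique (fun t : R => v t) _ _ (Hv t Ht)),
       (is_derive_unique (fun t : R => v' t) _ _ (Hv' t Ht)); field. }
  assert (Dax : forall s t, I s -> is_derive (fun s : R => a s t) s (ax s t)).
  { intros s t Hs; unfold a, ax; auto_derive.
    - repeat split; solve [exists (u'' s); auto | exists (ex s t); auto].
    - rewrite (is_derive_unique (fun s : R => u' s) _ _ (Hu' s Hs)),
        (is_derive_unique (fun s : R => e s t) _ _ (Dex s t Hs)); ring. }
  assert (Dbx : forall s t, I s -> is_derive (fun s : R => b s t) s (bx s t)).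
  { intros s t Hs; unfold b, bx, q; auto_derive.
    - repeat split; solve [exists (u'' s); auto | exists (ex s t); auto].
    - rewrite (is_derive_unique (fun s : R => u' s) _ _ (Hu' s Hs)),
        (is_derive_unique (fun s : R => e s t) _ _ (Dex s t Hs)); ring. }
  assert (Dcx : forall s t, I s -> is_derive (fun s : R => c s t) s (cx s t)).
  { intros s t Hs; unfold c, cx; auto_derive.
    - repeat split; solve [exists (ax s t); auto | exists (bx s t); auto
                          | exists (ex s t); auto].
    - rewrite (is_derive_unique (fun s : R => a s t) _ _ (Dax s t Hs)),
        (is_derive_unique (fun s : R => b s t) _ _ (Dbx s t Hs)),
        (is_derive_unique (fun s : R => e s t) _ _ (Dex s t Hs)); ring. }
  assert (Day : forall s t, J t -> is_derive (fun t : R => a s t) t (ay s t)).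
  { intros s t Ht; unfold a, ay; auto_derive.
    - repeat split; solve [exists (ey s t); auto].
    - rewrite (is_derive_unique (fun t : R => e s t) _ _ (Dey s t Ht)); ring. }
  assert (Dby : forall s t, J t -> is_derive (fun t : R => b s t) t (bt s t)).
  { intros s t Ht; unfold b, bt, q; auto_derive.
    - repeat split; solve [exists (v' t); auto | exists (v'' t); auto | exists (ey s t); auto].
    - rewrite (is_derive_unique (fun t : R => v t) _ _ (Hv t Ht)),
       (is_derive_unique (fun t : R => v' t) _ _ (Hv' t Ht)),
       (is_derive_unique (fun t : R => e s t) _ _ (Dey s t Ht)); field. }
  assert (Dcy : forall s t, J t -> is_derive (fun t : R => c s t) t (cy s t)).
  { intros s t Ht; unfold c, cy; auto_derive.
    - repeat split; solve [exists (ay s t); auto | exists (bt s t); auto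
                          | exists (ey s t); auto | exists (v' t); auto].
    - rewrite (is_derive_unique (fun t : R => v t) _ _ (Hv t Ht)),
        (is_derive_unique (fun t : R => a s t) _ _ (Day s t Ht)),
        (is_derive_unique (fun t : R => b s t) _ _ (Dby s t Ht)),
        (is_derive_unique (fun t : R => e s t) _ _ (Dey s t Ht)); ring. }
  set (N s t := (a s t, b s t, c s t)).
  assert (He : forall s t, nil_form (translation_surface5 u v s t) (N s t) = e s t).
  { intros s t; unfold nil_form; rewrite translation_surface5E; simpl; unfold c; ring. }
  set (A s t k := match k with O => ax s t | S O => bx s t | _ => cx s t end).
  set (B s t k := match k with O => ay s t | S O => bt s t | _ => cy s t end).
  assert (DA : forall s t, I s -> forall k,
            is_derive (fun s : R => coord k (N s t)) s (A s t k)).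
  { intros s t Hs [|[|k]]; simpl; auto. }
  assert (DB : forall s t, J t -> forall k,
            is_derive (fun t : R => coord k (N s t)) t (B s t k)).
  { intros s t Ht [|[|k]]; simpl; auto. }
  exists N; split.
  - intros s t [Hs Ht].
    rewrite (translation_surface5_tangent1 u v s t (u' s)) by auto.
    rewrite (translation_surface5_tangent2 u v s t (v' t)) by auto.
    unfold nil_metric; rewrite He.
    repeat split.
    + unfold nil_form; rewrite translation_surface5E; simpl; unfold a; field.
    + unfold nil_form; rewrite translation_surface5E; simpl; unfold a, b, q; field.
    + simpl; unfold a, b.
      transitivity (W s t * (e s t * e s t)); [unfold W; ring|].
      unfold e; rewrite <- Rinv_mult, sqrt_sqrt by (apply Rlt_le, HW).
      apply Rinv_r; generalize (HW s t); lra.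
    + intros k; eexists; now apply DA.
    + intros k; eexists; now apply DB.
  - intros x y [Hx Hy].
    (* The second frame components determine [a21] and [a22], then the first ones determine [a11]
       and [a12]. The third equations hold because [N] has constant length, so that its covariant
       derivatives are tangent. *)
    set (a21 := - (bx x y - (e x y + u' x * a x y) / 2)).
    set (a22 := - (bt x y - (v' y * e x y + q x y * a x y) / 2)).
    exists (- (ax x y + u' x * b x y / 2) - a21 * v' y),
      (- (ay x y + (q x y * b x y + e x y) / 2) - a22 * v' y), a21, a22.
    assert (Hne : W x y <> 0) by (generalize (HW x y); lra).
    split.
    + apply (shape_operator5 u v N x y (u' x) (v' y) (A x y) (B x y)); auto.
      rewrite He; simpl; fold (q x y).
      unfold a21, a22, cx, cy, bx, bt, ax, ay, ex, ey, b, a.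
      repeat split; try ring; field_simplify_eq; auto; unfold Wx, Wy, W; field.
    + specialize (Heq x y Hx Hy); unfold minimal_eq5 in Heq; fold (q x y) in Heq.
      unfold a21, a22, bx, bt, ax, ay, ex, ey, b, a.
      (* [2 W H] is [e] times the left side of the equation. *)
      apply Rmult_eq_reg_l with (2 * W x y); [|lra].
      transitivity (e x y * ((1 + v' y ^ 2 + q x y ^ 2) * u'' x +
        (1 + u' x ^ 2) * (y / 2 - u' x) * v'' y + v' y + u' x * q x y));
        [rewrite Heq; ring|].
      field_simplify_eq; auto; unfold Wx, Wy, W; field.
Qed.

(** * If [v''] is not identically zero, then [u''] vanishes *)

Lemma open_and_neq_0 (U : R -> Prop) (f f' : R -> R) :
  open U -> (forall x, U x -> is_derive f x (f' x)) ->
  open (fun x => U x /\ f x <> 0).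
Proof.
  intros HU Hf x [Hx Hfx].
  assert (Hc : continuous f x)
    by (apply (ex_derive_continuous (V := R_NormedModule)); exists (f' x); auto).
  apply filter_and; [now apply HU|].
  exact (Hc _ (open_neq 0 (f x) Hfx)).
Qed.

(** Chain rule, then division by [p']. The conclusion keeps a zero term of degree 4 so that the
    lemma can be applied to its own output. *)
Lemma quartic_deriv_comp_zero (U : R -> Prop) (p p' : R -> R) (c0 c1 c2 c3 c4 : R) :
  open U -> (forall x, U x -> is_derive p x (p' x) /\ p' x <> 0) ->
  (forall x, U x -> c0 + c1 * p x + c2 * p x ^ 2 + c3 * p x ^ 3 + c4 * p x ^ 4 = 0) ->
  forall x, U x -> c1 + 2 * c2 * p x + 3 * c3 * p x ^ 2 + 4 * c4 * p x ^ 3 + 0 * p x ^ 4 = 0.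
Proof.
  intros HU Hp H x Hx; destruct (Hp x Hx) as [Dp Np].
  apply Rmult_eq_reg_l with (p' x); [rewrite Rmult_0_r|exact Np].
  apply (is_derive_zero_on_open U _ x _ HU Hx H).
  auto_derive; [repeat split; now exists (p' x)|].
  rewrite (is_derive_unique (fun t : R => p t) _ _ Dp); ring.
Qed.

(** The relation and its four formal derivatives at [x0] form a triangular system in the
    coefficients, solved from [c4] downwards. *)
Lemma quartic_comp_zero (U : R -> Prop) (p p' : R -> R) (x0 c0 c1 c2 c3 c4 : R) :
  open U -> U x0 -> (forall x, U x -> is_derive p x (p' x) /\ p' x <> 0) ->
  (forall x, U x -> c0 + c1 * p x + c2 * p x ^ 2 + c3 * p x ^ 3 + c4 * p x ^ 4 = 0) ->
  c0 = 0 /\ c1 = 0 /\ c2 = 0 /\ c3 = 0 /\ c4 = 0.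
Proof.
  intros HU Hx0 Hp H0.
  assert (H1 := quartic_deriv_comp_zero U p p' _ _ _ _ _ HU Hp H0).
  assert (H2 := quartic_deriv_comp_zero U p p' _ _ _ _ _ HU Hp H1).
  assert (H3 := quartic_deriv_comp_zero U p p' _ _ _ _ _ HU Hp H2).
  assert (H4 := quartic_deriv_comp_zero U p p' _ _ _ _ _ HU Hp H3).
  specialize (H0 x0 Hx0); specialize (H1 x0 Hx0); specialize (H2 x0 Hx0);
    specialize (H3 x0 Hx0); specialize (H4 x0 Hx0).
  assert (E4 : c4 = 0) by lra; subst c4.
  assert (E3 : c3 = 0) by lra; subst c3.
  assert (E2 : c2 = 0) by lra; subst c2.
  assert (E1 : c1 = 0) by lra; subst c1.
  repeat split; lra.
Qed.

(* Here [p] stands for [u'].  Differentiating the second relation in [x] and eliminating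
   [x] with the relation itself leaves a quartic polynomial in [p]. *)
Lemma no_affine_slope (U : R -> Prop) (p p' : R -> R) (x0 al be k c d : R) :
  open U -> U x0 -> (forall x, U x -> is_derive p x (p' x) /\ p' x <> 0) ->
  (forall x, U x -> p' x = (1 + p x ^ 2) * (al + be * p x)) ->
  (forall x, U x ->
     p' x * (k - x) + (1 + p x ^ 2) * (c + d * p x) + p x / 2 = 0) ->
  False.
Proof.
  intros HU Hx0 Hp Hp' Hk.
  set (g := al * d - be * c).
  assert (HT : forall x, U x ->
    (g - al / 2) + (- be) * p x + (2 * g - 3 * al / 2) * p x ^ 2
      + (- 2 * be) * p x ^ 3 + g * p x ^ 4 = 0).
  { intros x Hx; destruct (Hp x Hx) as [Dp Np].
    set (P := p x).
    assert (H : p' x * ((2 * P * (al + be * P) + be * (1 + P ^ 2)) * (k - x) - 1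
                  + (2 * P * (c + d * P) + d * (1 + P ^ 2) + / 2)) = 0).
    { apply (is_derive_zero_on_open U (fun x => (1 + p x ^ 2) * (al + be * p x) * (k - x)
          + (1 + p x ^ 2) * (c + d * p x) + p x / 2) x); auto.
      - intros t Ht; rewrite <- Hp' by auto; auto.
      - auto_derive; [repeat split; now exists (p' x)|].
        rewrite (is_derive_unique (fun t : R => p t) _ _ Dp).
        unfold P; rewrite (Hp' x Hx); field. }
    apply Rmult_integral in H; destruct H as [H|H]; [contradiction|].
    assert (E := Hk x Hx); rewrite (Hp' x Hx) in E; fold P in E.
    transitivity ((1 + P ^ 2) * (al + be * P) *
       ((2 * P * (al + be * P) + be * (1 + P ^ 2)) * (k - x) - 1
                  + (2 * P * (c + d * P) + d * (1 + P ^ 2) + / 2))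
       - (2 * P * (al + be * P) + be * (1 + P ^ 2)) *
       ((1 + P ^ 2) * (al + be * P) * (k - x) + (1 + P ^ 2) * (c + d * P) + P / 2));
      [unfold g; field | rewrite H, E; ring]. }
  (* The coefficient of degree 1 gives [be = 0], that of degree 4 gives [g = 0], and the constant
     one then gives [al = 0], so [p'] would vanish. *)
  destruct (quartic_comp_zero U p p' x0 _ _ _ _ _ HU Hx0 Hp HT) as (E0 & E1 & _ & _ & E4).
  apply (proj2 (Hp x0 Hx0)); rewrite (Hp' x0 Hx0).
  replace be with 0 by lra; replace al with 0 by lra; ring.
Qed.

(* [m] stands for [v'''/v'']: after division by [v''], two more derivatives in [y] reduce the
   equation to one that is affine in [u'/(1 + u'^2)] and [u']. *)
Lemma minimal_eq5_not_both_curved (U V : R -> Prop) (p p' v v' v'' m m' m'' : R -> R)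
  (x0 y0 : R) :
  open U -> open V -> U x0 -> V y0 ->
  (forall x, U x -> is_derive p x (p' x) /\ p' x <> 0) ->
  (forall y, V y -> is_derive v y (v' y)) -> (forall y, V y -> is_derive v' y (v'' y)) ->
  (forall y, V y -> is_derive v'' y (m y * v'' y) /\ v'' y <> 0) ->
  (forall y, V y -> is_derive m y (m' y)) -> (forall y, V y -> is_derive m' y (m'' y)) ->
  (forall x y, U x -> V y -> minimal_eq5 x y (p x) (p' x) (v y) (v' y) (v'' y)) ->
  False.
Proof.
  intros HU HV Hx0 Hy0 Hp Hv Hv' Hv'' Hm Hm' Heq.
  set (q x y := (y * v' y - v y) / 2 - x).
  assert (H1 : forall x y, U x -> V y ->
    p' x * (2 * v' y + y * q x y) + (1 + p x ^ 2) * (/ 2 + (y / 2 - p x) * m y)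
    + 1 + p x * y / 2 = 0).
  { intros x y Hx Hy; destruct (Hv'' y Hy) as [Dv'' Nv''].
    apply Rmult_eq_reg_l with (v'' y); [rewrite Rmult_0_r|exact Nv''].
    apply (is_derive_zero_on_open V _ y _ HV Hy (fun t Ht => Heq x t Hx Ht)).
    auto_derive.
    - repeat split; solve [exists (v' y); auto | exists (v'' y); auto
                          | exists (m y * v'' y); auto].
    - rewrite (is_derive_unique (fun t : R => v t) _ _ (Hv y Hy)),
        (is_derive_unique (fun t : R => v' t) _ _ (Hv' y Hy)),
        (is_derive_unique (fun t : R => v'' t) _ _ Dv''); unfold q; field. }
  assert (H2 : forall x y, U x -> V y ->
    p' x * ((2 + y ^ 2 / 2) * v'' y + q x y) + (1 + p x ^ 2) * (m y / 2 + (y / 2 - p x) * m' y)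
    + p x / 2 = 0).
  { intros x y Hx Hy.
    apply (is_derive_zero_on_open V _ y _ HV Hy (fun t Ht => H1 x t Hx Ht)).
    unfold q; auto_derive.
    - repeat split; solve [exists (v' y); auto | exists (v'' y); auto
                          | exists (m' y); auto].
    - rewrite (is_derive_unique (fun t : R => v t) _ _ (Hv y Hy)),
        (is_derive_unique (fun t : R => v' t) _ _ (Hv' y Hy)),
        (is_derive_unique (fun t : R => m t) _ _ (Hm y Hy)); field. }
  (* [k'] is the derivative of [(2 + y^2/2) v'' + q], the coefficient of [p'] in [H2]. *)
  set (k' y := v'' y * ((2 + y ^ 2 / 2) * m y + 3 * y / 2)).
  assert (H3 : forall x y, U x -> V y ->
    p' x * k' y + (1 + p x ^ 2) * (m' y + (y / 2 - p x) * m'' y) = 0).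
  { intros x y Hx Hy; destruct (Hv'' y Hy) as [Dv'' Nv''].
    apply (is_derive_zero_on_open V _ y _ HV Hy (fun t Ht => H2 x t Hx Ht)).
    unfold q; auto_derive.
    - repeat split; solve [exists (v' y); auto | exists (v'' y); auto
                   | exists (m y * v'' y); auto | exists (m' y); auto | exists (m'' y); auto].
    - rewrite (is_derive_unique (fun t : R => v t) _ _ (Hv y Hy)),
        (is_derive_unique (fun t : R => v' t) _ _ (Hv' y Hy)),
        (is_derive_unique (fun t : R => v'' t) _ _ Dv''),
        (is_derive_unique (fun t : R => m t) _ _ (Hm y Hy)),
        (is_derive_unique (fun t : R => m' t) _ _ (Hm' y Hy)); unfold k'; field. }
  destruct (classic (exists y, V y /\ k' y <> 0)) as [(y & Hy & Hk)|Hk].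
  (* With this [y] frozen, [H3] solved for [p'] is the first relation of [no_affine_slope] and [H2]
     is the second. *)
  - apply (no_affine_slope U p p' x0 (- (m' y + y / 2 * m'' y) / k' y) (m'' y / k' y)
      ((2 + y ^ 2 / 2) * v'' y + (y * v' y - v y) / 2) (m y / 2 + y / 2 * m' y) (- m' y)); auto.
    + intros x Hx; apply Rmult_eq_reg_r with (k' y); [|exact Hk].
      specialize (H3 x y Hx Hy).
      apply Rminus_diag_uniq; rewrite <- H3; field; exact Hk.
    + intros x Hx; rewrite <- (H2 x y Hx Hy); unfold q; field.
  (* Now [k'] vanishes identically. As [p] is not constant, [H3] forces [m'' = m' = 0].
     Differentiating [K0] twice with [m' = 0] gives first [y m = - 3/2] and then [m = 0], a
     contradiction. *)
  - assert (K0 : forall y, V y -> (2 + y ^ 2 / 2) * m y + 3 * y / 2 = 0).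
    { intros y Hy; apply NNPP; intros N; apply Hk; exists y; split; [exact Hy|].
      unfold k'; apply Rmult_integral_contrapositive_currified; [apply Hv''|]; auto. }
    assert (M0 : forall x y, U x -> V y -> m' y + (y / 2 - p x) * m'' y = 0).
    { intros x y Hx Hy; specialize (H3 x y Hx Hy); unfold k' in H3; rewrite (K0 y Hy) in H3.
      assert (N := pow2_ge_0 (p x)); apply Rmult_eq_reg_l with (1 + p x ^ 2); lra. }
    assert (M : forall y, V y -> m' y = 0).
    { intros y Hy; destruct (Hp x0 Hx0) as [Dp Np].
      assert (E : p' x0 * - m'' y = 0).
      { apply (is_derive_zero_on_open U _ x0 _ HU Hx0 (fun t Ht => M0 t y Ht Hy)).
        auto_derive; [now exists (p' x0)|].
        rewrite (is_derive_unique (fun t : R => p t) _ _ Dp); ring. }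
      apply Rmult_integral in E; destruct E as [E|E]; [contradiction|].
      specialize (M0 x0 y Hx0 Hy); replace (m'' y) with 0 in M0 by lra; lra. }
    assert (K1 : forall y, V y -> y * m y + 3 / 2 = 0).
    { intros y Hy.
      apply (is_derive_zero_on_open V _ y _ HV Hy K0).
      auto_derive; [now exists (m' y); auto|].
      rewrite (is_derive_unique (fun t : R => m t) _ _ (Hm y Hy)), (M y Hy); field. }
    assert (K2 : m y0 = 0).
    { apply (is_derive_zero_on_open V _ y0 _ HV Hy0 K1).
      auto_derive; [now exists (m' y0); auto|].
      rewrite (is_derive_unique (fun t : R => m t) _ _ (Hm y0 Hy0)), (M y0 Hy0); field. }
    specialize (K1 y0 Hy0); rewrite K2 in K1; lra.
Qed.

(** If [u''] were nonzero somewhere, the previous lemma would apply on the open sets where [u''] and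
    [v''] do not vanish. There [m = v3 / v''], whose second derivative involves [v5]. *)
Lemma minimal_eq5_u''_zero (I J : R -> Prop)
  (u' u'' u''' v v' v'' v3 v4 v5 : R -> R) (y0 : R) :
  open I -> open J ->
  (forall x, I x -> is_derive u' x (u'' x)) -> (forall x, I x -> is_derive u'' x (u''' x)) ->
  (forall y, J y -> is_derive v y (v' y)) -> (forall y, J y -> is_derive v' y (v'' y)) ->
  (forall y, J y -> is_derive v'' y (v3 y)) -> (forall y, J y -> is_derive v3 y (v4 y)) ->
  (forall y, J y -> is_derive v4 y (v5 y)) ->
  (forall x y, I x -> J y -> minimal_eq5 x y (u' x) (u'' x) (v y) (v' y) (v'' y)) ->
  J y0 -> v'' y0 <> 0 -> forall x, I x -> u'' x = 0.
Proof.
  intros HI HJ Hu' Hu'' Hv Hv' Hv'' Hv3 Hv4 Heq Hy0 N0 x0 Hx0.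
  apply NNPP; intros Nx0.
  assert (HU := open_and_neq_0 I u'' u''' HI Hu'').
  assert (HV := open_and_neq_0 J v'' v3 HJ Hv'').
  apply (minimal_eq5_not_both_curved (fun x => I x /\ u'' x <> 0) (fun y => J y /\ v'' y <> 0)
    u' u'' v v' v'' (fun y => v3 y / v'' y)
    (fun y => v4 y / v'' y - (v3 y / v'' y) ^ 2)
    (fun y => v5 y / v'' y - v4 y * v3 y / v'' y ^ 2
      - 2 * (v3 y / v'' y) * (v4 y / v'' y - (v3 y / v'' y) ^ 2)) x0 y0); auto.
  - intros x [Hx Nx]; auto.
  - intros y [Hy _]; auto.
  - intros y [Hy _]; auto.
  - intros y [Hy Ny]; split; [|exact Ny].
    replace (v3 y / v'' y * v'' y) with (v3 y) by (field; exact Ny); auto.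
  - intros y [Hy Ny]; auto_derive.
    + repeat split; auto; solve [exists (v3 y); auto | exists (v4 y); auto].
    + rewrite (is_derive_unique (fun t : R => v'' t) _ _ (Hv'' y Hy)),
        (is_derive_unique (fun t : R => v3 t) _ _ (Hv3 y Hy)); field; auto.
  - intros y [Hy Ny]; auto_derive.
    + repeat split; auto;
        solve [exists (v3 y); auto | exists (v4 y); auto | exists (v5 y); auto].
    + rewrite (is_derive_unique (fun t : R => v'' t) _ _ (Hv'' y Hy)),
        (is_derive_unique (fun t : R => v3 t) _ _ (Hv3 y Hy)),
        (is_derive_unique (fun t : R => v4 t) _ _ (Hv4 y Hy)); field; auto.
  - intros x y [Hx _] [Hy _]; auto.
Qed.

(** * Integration on intervals and the case of affine [v] *)

Lemma open_Rbar_open_interval (a b : Rbar) : open (Rbar_open_interval a b).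
Proof. apply open_and; [apply open_Rbar_gt | apply open_Rbar_lt]. Qed.

Lemma Rbar_open_interval_inhabited (a b : Rbar) :
  Rbar_lt a b -> exists x : R, Rbar_open_interval a b x.
Proof.
  unfold Rbar_open_interval; destruct a as [a| |], b as [b| |]; simpl; intros H; try tauto.
  - exists ((a + b) / 2); lra.
  - exists (a + 1); lra.
  - exists (b - 1); lra.
  - exists 0; auto.
Qed.

Lemma is_derive_zero_const (a b : Rbar) (f : R -> R) :
  (forall x, Rbar_open_interval a b x -> is_derive f x 0) ->
  forall x y, Rbar_open_interval a b x -> Rbar_open_interval a b y -> f x = f y.
Proof.
  intros Hf.
  assert (H : forall x y, Rbar_open_interval a b x -> Rbar_open_interval a b y ->
            x < y -> f x = f y).
  { intros x y [Hx _] [_ Hy] Hxy.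
    apply (eq_is_derive (V := R_NormedModule)); [|exact Hxy].
    intros t [Ht1 Ht2]; apply Hf; split.
    - apply Rbar_lt_le_trans with x; [exact Hx | exact Ht1].
    - apply Rbar_le_lt_trans with y; [exact Ht2 | exact Hy]. }
  intros x y Hx Hy; destruct (Rtotal_order x y) as [L|[->|L]]; auto.
  symmetry; auto.
Qed.

Lemma is_derive_Derive_n_smooth (D : R -> Prop) (f : R -> R) (n : nat) (x : R) :
  smooth_on D f -> D x -> is_derive (Derive_n f n) x (Derive_n f (S n) x).
Proof. intros Hf Hx; apply Derive_correct, (Hf (S n) x Hx). Qed.

(* A primitive of [2 c1 sqrt (1 + a^2 + s^2)] in terms of [s = x + b/2], plus a particular
   solution. *)
Definition flat_profile (a b c c1 x : R) : R :=
  - ((a * x ^ 2 + a * b * x + c) / (2 * (1 + a ^ 2)))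
  + c1 * (x / 2 + b / 4) * sqrt (4 * (1 + a ^ 2) + (2 * x + b) ^ 2)
  + c1 * (1 + a ^ 2)
    * ln (2 * x + b + sqrt (4 * (1 + a ^ 2) + (2 * x + b) ^ 2)).

Definition flat_profile' (a b c1 x : R) : R :=
  - (a * (2 * x + b) / (2 * (1 + a ^ 2)))
  + c1 * sqrt (4 * (1 + a ^ 2) + (2 * x + b) ^ 2).

Lemma flat_radicand_pos (a b x : R) : 0 < 4 * (1 + a ^ 2) + (2 * x + b) ^ 2.
Proof.
  assert (H1 := pow2_ge_0 a); assert (H2 := pow2_ge_0 (2 * x + b)); lra.
Qed.

Lemma is_derive_flat_profile (a b c c1 x : R) :
  is_derive (flat_profile a b c c1) x (flat_profile' a b c1 x).
Proof.
  assert (Ha := pow2_ge_0 a); assert (HT := flat_radicand_pos a b x).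
  set (T := 4 * (1 + a ^ 2) + (2 * x + b) ^ 2) in *.
  assert (HS := sqrt_lt_R0 _ HT).
  assert (HSS : sqrt T ^ 2 = T) by (apply pow2_sqrt; lra).
  (* The argument of the logarithm is positive because the root exceeds the absolute value of
     [2 x + b]. *)
  assert (HL : 0 < 2 * x + b + sqrt T).
  { assert (Rabs (2 * x + b) < sqrt T).
    { rewrite <- sqrt_Rsqr_abs; apply sqrt_lt_1_alt; split; [apply Rle_0_sqr|].
      unfold T, Rsqr; lra. }
    assert (H' := Rle_abs (- (2 * x + b))); rewrite Rabs_Ropp in H'; lra. }
  unfold flat_profile, flat_profile'.
  auto_derive;
    change (4 * (1 + a * (a * 1)) + (2 * x + b) * ((2 * x + b) * 1)) with T.
  - repeat split; auto; lra.
  - fold T; change (1 + a * (a * 1)) with (1 + a ^ 2); set (S := sqrt T) in *.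
    (* Eliminating [1 + a^2] from the logarithmic term in favour of [S] makes the identity rational
       in a free variable [S]. *)
    assert (E : 4 * (1 + a ^ 2) = S ^ 2 - (2 * x + b) ^ 2) by (rewrite HSS; unfold T; ring).
    replace (c1 * (1 + a ^ 2)) with (c1 * ((S ^ 2 - (2 * x + b) ^ 2) / 4))
      by (rewrite <- E; field).
    clearbody S; field; lra.
Qed.

Lemma is_derive_flat_profile' (a b c1 x : R) :
  is_derive (flat_profile' a b c1) x
    (- (a / (1 + a ^ 2))
     + 2 * c1 * (2 * x + b) / sqrt (4 * (1 + a ^ 2) + (2 * x + b) ^ 2)).
Proof.
  assert (Ha := pow2_ge_0 a); assert (HT := flat_radicand_pos a b x).
  assert (HS := sqrt_lt_R0 _ HT).
  unfold flat_profile'; auto_derive; [repeat split; auto; lra|].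
  change (4 * (1 + a * (a * 1)) + (2 * x + b) * ((2 * x + b) * 1))
    with (4 * (1 + a ^ 2) + (2 * x + b) ^ 2).
  field; lra.
Qed.

(** With [s = x + b/2] the equation is linear in [u']: a particular solution is [- a s / (1 + a^2)],
    and [sqrt (1 + a^2 + s^2)] solves the homogeneous equation. Two integrations produce [c1] and
    [c]. *)
Lemma flat_profile_unique (a b : R) (i0 i1 : Rbar) (u u' u'' : R -> R) :
  Rbar_lt i0 i1 ->
  (forall x, Rbar_open_interval i0 i1 x -> is_derive u x (u' x)) ->
  (forall x, Rbar_open_interval i0 i1 x -> is_derive u' x (u'' x)) ->
  (forall x, Rbar_open_interval i0 i1 x ->
     (1 + a ^ 2 + (x + b / 2) ^ 2) * u'' x + a - u' x * (x + b / 2) = 0) ->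
  exists c c1, forall x, Rbar_open_interval i0 i1 x -> u x = flat_profile a b c c1 x.
Proof.
  intros HI Hu Hu' Hode.
  destruct (Rbar_open_interval_inhabited _ _ HI) as [x0 Hx0].
  assert (Ha := pow2_ge_0 a).
  set (S x := sqrt (4 * (1 + a ^ 2) + (2 * x + b) ^ 2)).
  assert (HS : forall x, 0 < S x) by (intros x; apply sqrt_lt_R0, flat_radicand_pos).
  assert (HSS : forall x, S x ^ 2 = 4 * (1 + a ^ 2) + (2 * x + b) ^ 2)
    by (intros x; apply pow2_sqrt, Rlt_le, flat_radicand_pos).
  assert (DS : forall x, is_derive S x (2 * (2 * x + b) / S x)).
  { intros x; assert (HT := flat_radicand_pos a b x); assert (H := HS x).
    unfold S; auto_derive; [repeat split; auto|].
    change (sqrt (4 * (1 + a * (a * 1)) + (2 * x + b) * ((2 * x + b) * 1))) with (S x).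
    fold (S x); field; lra. }
  (* Variation of constants: [k] is the quotient of [u'] minus the particular solution by the
     homogeneous one, and it is shown to be constant. *)
  set (k x := (u' x + a * (2 * x + b) / (2 * (1 + a ^ 2))) / S x).
  assert (Hk : forall x, Rbar_open_interval i0 i1 x -> is_derive k x 0).
  { intros x Hx; assert (H := HS x); unfold k; auto_derive.
    - repeat split; solve [exists (u'' x); auto | eexists; apply DS | lra].
    - rewrite (is_derive_unique (fun t : R => u' t) _ _ (Hu' x Hx)),
        (is_derive_unique (fun t : R => S t) _ _ (DS x)).
      change (1 + a * (a * 1)) with (1 + a ^ 2).
      assert (E := Hode x Hx); assert (E2 := HSS x).
      assert (E3 : S x ^ 2 * u'' x + 4 * a = 2 * (2 * x + b) * u' x) by (rewrite E2; lra).
      apply Rmult_eq_reg_l with (S x ^ 3); [|apply pow_nonzero; lra].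
      transitivity ((S x ^ 2 * u'' x + 4 * a) - 2 * (2 * x + b) * u' x
                    + a / (1 + a ^ 2) * (S x ^ 2 - (4 * (1 + a ^ 2) + (2 * x + b) ^ 2)));
        [field; lra|].
      rewrite E3, E2; ring. }
  set (c1 := k x0).
  assert (Hu'1 : forall x, Rbar_open_interval i0 i1 x -> u' x = flat_profile' a b c1 x).
  { intros x Hx; assert (E : k x = c1) by (apply (is_derive_zero_const i0 i1); auto).
    unfold flat_profile'; fold (S x); rewrite <- E; unfold k; field.
    generalize (HS x); split; lra. }
  set (d := u x0 - flat_profile a b 0 c1 x0).
  (* The additive constant [d] is absorbed in [c], which enters the profile as
     [- c / (2 (1 + a^2))]. *)
  exists (- d * (2 * (1 + a ^ 2))), c1; intros x Hx.
  assert (E : u x - flat_profile a b 0 c1 x = d).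
  { apply (is_derive_zero_const i0 i1 (fun x => u x - flat_profile a b 0 c1 x)); auto.
    intros t Ht; replace 0 with (u' t - flat_profile' a b c1 t)
      by (rewrite Hu'1 by auto; ring).
    apply (is_derive_minus (V := R_NormedModule)); [auto | apply is_derive_flat_profile]. }
  replace (u x) with (flat_profile a b 0 c1 x + d) by lra.
  unfold flat_profile; field; lra.
Qed.

(** By continuity. It serves at [y = 0], where form (i) says nothing about [v] but the surface must
    still satisfy the equation. *)
Lemma zero_of_zero_off_point (U : R -> Prop) (f : R -> R) (x : R) :
  open U -> U x -> ex_derive f x ->
  (forall t, U t -> t <> x -> f t = 0) -> f x = 0.
Proof.
  intros HU Hx Hf H; apply NNPP; intros N.
  assert (Hc : continuous f x) by (apply (ex_derive_continuous (V := R_NormedModule)), Hf).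
  destruct (filter_and _ _ (HU x Hx) (Hc _ (open_neq 0 (f x) N))) as [eps Heps].
  assert (Hp := cond_pos eps).
  destruct (Heps (x + eps / 2)) as [HU' HN].
  - unfold ball; simpl; unfold AbsRing_ball, abs, minus, plus, opp; simpl.
    rewrite Rabs_pos_eq; lra.
  - apply HN, H; [exact HU' | lra].
Qed.

(** * The two families of minimal surfaces of type 5 *)

Theorem theorem3p6 (i0 i1 j0 j1 : Rbar)
  (hI : Rbar_lt i0 i1) (hJ : Rbar_lt j0 j1) (u v : R -> R)
  (hu : smooth_on (Rbar_open_interval i0 i1) u)
  (hv : smooth_on (Rbar_open_interval j0 j1) v) :
  minimal nil_metric
    (fun x y => Rbar_open_interval i0 i1 x /\ Rbar_open_interval j0 j1 y)
    (translation_surface5 u v)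
  <->
  (exists u0 a b : R,
     (forall x : R, Rbar_open_interval i0 i1 x -> u x = u0) /\
     (forall y : R, Rbar_open_interval j0 j1 y -> y <> 0 -> v y = a / y + b))
  \/
  (exists a b c c1 : R,
     (forall y : R, Rbar_open_interval j0 j1 y -> v y = a * y + b) /\
     (forall x : R, Rbar_open_interval i0 i1 x ->
        u x =
          - ((a * x ^ 2 + a * b * x + c) / (2 * (1 + a ^ 2)))
          + c1 * (x / 2 + b / 4) * sqrt (4 * (1 + a ^ 2) + (2 * x + b) ^ 2)
          + c1 * (1 + a ^ 2)
            * ln (2 * x + b + sqrt (4 * (1 + a ^ 2) + (2 * x + b) ^ 2)))).
Proof.
  set (I := Rbar_open_interval i0 i1) in *; set (J := Rbar_open_interval j0 j1) in *.
  assert (HI : open I) by apply open_Rbar_open_interval.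
  assert (HJ : open J) by apply open_Rbar_open_interval.
  assert (Du : forall n x, I x -> is_derive (Derive_n u n) x (Derive_n u (S n) x))
    by (intros n x; now apply is_derive_Derive_n_smooth).
  assert (Dv : forall n y, J y -> is_derive (Derive_n v n) y (Derive_n v (S n) y))
    by (intros n y; now apply is_derive_Derive_n_smooth).
  assert (Hmin : minimal nil_metric (fun x y => I x /\ J y) (translation_surface5 u v) <->
    forall x y, I x -> J y ->
      minimal_eq5 x y (Derive_n u 1 x) (Derive_n u 2 x) (v y) (Derive_n v 1 y) (Derive_n v 2 y)).
  { split.
    - apply minimal_eq5_of_minimal; auto; [apply (Du 0%nat) | apply (Dv 0%nat)].
    - apply minimal_of_minimal_eq5; auto; [apply (Du 0%nat) | apply (Dv 0%nat)]. }
  rewrite Hmin; clear Hmin; split.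
  - intros Heq.
    destruct (classic (exists y, J y /\ Derive_n v 2 y <> 0)) as [(y0 & Hy0 & Nv)|Hv2].
    + left.
      destruct (Rbar_open_interval_inhabited _ _ hI) as [x0 Hx0]; fold I in Hx0.
      assert (Hu2 : forall x, I x -> Derive_n u 2 x = 0).
      { apply (minimal_eq5_u''_zero I J (Derive_n u 1) (Derive_n u 2) (Derive_n u 3)
          v (Derive_n v 1) (Derive_n v 2) (Derive_n v 3) (Derive_n v 4) (Derive_n v 5) y0);
          auto; apply (Dv 0%nat). }
      set (p := Derive_n u 1 x0).
      assert (Hp : forall x, I x -> Derive_n u 1 x = p).
      { intros x Hx; apply (is_derive_zero_const i0 i1); auto.
        intros t Ht; rewrite <- (Hu2 t Ht); auto. }
      (* With [u' = p] constant, the equation at [y0] is affine in [x] with slope [- p]. *)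
      assert (Hp0 : p = 0).
      { apply Ropp_eq_reg; rewrite Ropp_0.
        apply (is_derive_zero_on_open I (fun x => (1 + p ^ 2) * (y0 / 2 - p) * Derive_n v 2 y0
          + Derive_n v 1 y0 + p * ((y0 * Derive_n v 1 y0 - v y0) / 2 - x)) x0); auto.
        - intros t Ht; rewrite <- (Heq t y0 Ht Hy0), (Hu2 t Ht), (Hp t Ht); ring.
        - auto_derive; trivial; ring. }
      rewrite Hp0 in Hp; clear p Hp0.
      assert (Hode : forall y, J y -> y * Derive_n v 2 y + 2 * Derive_n v 1 y = 0).
      { intros y Hy; assert (E := Heq x0 y Hx0 Hy); unfold minimal_eq5 in E.
        rewrite (Hu2 x0 Hx0), (Hp x0 Hx0) in E; lra. }
      assert (D1 : forall y, J y -> is_derive (fun y => y * Derive_n v 1 y + v y) y 0).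
      { intros y Hy; auto_derive.
        - repeat split; [exists (Derive_n v 2 y); exact (Dv 1%nat y Hy)
                        | exists (Derive_n v 1 y); exact (Dv 0%nat y Hy)].
        - change (Derive (fun t : R => Derive (fun s : R => v s) t) y) with (Derive_n v 2 y).
          change (Derive (fun s : R => v s) y) with (Derive_n v 1 y).
          rewrite <- (Hode y Hy); ring. }
      (* [y v' + v] is the derivative of [y v]. Hence [y v - b y] is constant too, and its value at
         [y0] is the witness for [a]. *)
      set (b := y0 * Derive_n v 1 y0 + v y0).
      assert (Hb : forall y, J y -> y * Derive_n v 1 y + v y = b)
        by (intros y Hy;
            apply (is_derive_zero_const j0 j1 (fun y => y * Derive_n v 1 y + v y)); auto).
      exists (u x0), (y0 * v y0 - b * y0), b; split.
      * intros x Hx; apply (is_derive_zero_const i0 i1); auto.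
        intros t Ht; rewrite <- (Hp t Ht); apply (Du 0%nat); auto.
      * intros y Hy Ny.
        assert (E : y * v y - b * y = y0 * v y0 - b * y0).
        { apply (is_derive_zero_const j0 j1 (fun y => y * v y - b * y)); auto.
          intros t Ht; auto_derive.
          - repeat split; exists (Derive_n v 1 t); exact (Dv 0%nat t Ht).
          - change (Derive (fun s : R => v s) t) with (Derive_n v 1 t).
            rewrite <- (Hb t Ht); ring. }
        rewrite <- E; field; exact Ny.
    + right.
      destruct (Rbar_open_interval_inhabited _ _ hJ) as [y0 Hy0]; fold J in Hy0.
      assert (Hv0 : forall y, J y -> Derive_n v 2 y = 0)
        by (intros y Hy; apply NNPP; intros N; apply Hv2; exists y; auto).
      set (a := Derive_n v 1 y0).
      assert (Ha : forall y, J y -> Derive_n v 1 y = a).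
      { intros y Hy; apply (is_derive_zero_const j0 j1); auto.
        intros t Ht; rewrite <- (Hv0 t Ht); auto. }
      set (b := v y0 - a * y0).
      assert (Hb : forall y, J y -> v y = a * y + b).
      { intros y Hy; assert (E : v y - a * y = b); [|lra].
        apply (is_derive_zero_const j0 j1 (fun y => v y - a * y)); auto.
        intros t Ht; auto_derive.
        - exists (Derive_n v 1 t); exact (Dv 0%nat t Ht).
        - change (Derive (fun s : R => v s) t) with (Derive_n v 1 t).
          rewrite (Ha t Ht); ring. }
      destruct (flat_profile_unique a b i0 i1 u (Derive_n u 1) (Derive_n u 2) hI) as (c & c1 & E);
        auto; [apply (Du 0%nat)| |].
      (* For [v = a y + b] the quantity [q] reduces to [- (x + b/2)], independent of [y], so the
         single value [y0] suffices. *)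
      * intros x Hx; assert (E := Heq x y0 Hx Hy0); unfold minimal_eq5 in E.
        rewrite (Hv0 y0 Hy0), (Hb y0 Hy0), (Ha y0 Hy0) in E.
        rewrite <- E; field.
      * exists a, b, c, c1; split; [exact Hb | exact E].
  - intros [(u0 & a & b & Hu & Hv)|(a & b & c & c1 & Hv & Hu)] x y Hx Hy; unfold minimal_eq5.
    + assert (Hu1 : forall t, I t -> Derive_n u 1 t = 0).
      { intros t Ht; apply (is_derive_zero_on_open I (fun t => u t - u0) t); auto.
        - intros s Hs; rewrite Hu by auto; ring.
        - auto_derive; [exists (Derive_n u 1 t); exact (Du 0%nat t Ht)|].
          change (Derive (fun s : R => u s) t) with (Derive_n u 1 t); ring. }
      rewrite (is_derive_zero_on_open I (Derive_n u 1) x (Derive_n u 2 x)), (Hu1 x Hx); auto.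
      (* Away from [0], the identity [y v = a + b y] is differentiated twice; the result extends to
         [0] by continuity. *)
      set (J' := fun t => J t /\ t <> 0).
      assert (HJ' : open J') by (apply open_and; [exact HJ | apply open_neq]).
      assert (H1 : forall t, J' t -> t * Derive_n v 1 t + v t - b = 0).
      { intros t Ht; apply (is_derive_zero_on_open J' (fun t => t * v t - a - b * t) t); auto.
        - intros s [Hs Ns]; rewrite Hv by auto; field; exact Ns.
        - destruct Ht as [Ht _]; auto_derive;
            [repeat split; exists (Derive_n v 1 t); exact (Dv 0%nat t Ht)|].
          change (Derive (fun s : R => v s) t) with (Derive_n v 1 t); ring. }
      assert (H2 : forall t, J' t -> t * Derive_n v 2 t + 2 * Derive_n v 1 t = 0).
      { intros t Ht;
          apply (is_derive_zero_on_open J' (fun t => t * Derive_n v 1 t + v t - b) t); auto.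
        destruct Ht as [Ht _]; auto_derive.
        - repeat split; [exists (Derive_n v 2 t); exact (Dv 1%nat t Ht)
                        | exists (Derive_n v 1 t); exact (Dv 0%nat t Ht)].
        - change (Derive (fun r : R => Derive (fun s : R => v s) r) t) with (Derive_n v 2 t).
          change (Derive (fun s : R => v s) t) with (Derive_n v 1 t); ring. }
      assert (H3 : y * Derive_n v 2 y + 2 * Derive_n v 1 y = 0).
      { destruct (Req_dec y 0) as [E|N]; [|apply H2; split; auto].
        apply (zero_of_zero_off_point J (fun t => t * Derive_n v 2 t + 2 * Derive_n v 1 t) y); auto.
        - auto_derive; repeat split;
            [exists (Derive_n v 3 y); exact (Dv 2%nat y Hy)
            | exists (Derive_n v 2 y); exact (Dv 1%nat y Hy)].
        - intros t Ht Nt; apply H2; split; [auto | now rewrite <- E]. }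
      lra.
    + assert (Hu1 : forall t, I t -> Derive_n u 1 t = flat_profile' a b c1 t).
      { intros t Ht; apply Rminus_diag_uniq.
        apply (is_derive_zero_on_open I (fun t => u t - flat_profile a b c c1 t) t); auto.
        - intros s Hs; rewrite Hu by auto; unfold flat_profile; ring.
        - apply (is_derive_minus (V := R_NormedModule));
            [apply (Du 0%nat); auto | apply is_derive_flat_profile]. }
      assert (Hu2 := is_derive_zero_on_open I (fun t => Derive_n u 1 t - flat_profile' a b c1 t) x _
        HI Hx (fun t Ht => Rminus_diag_eq _ _ (Hu1 t Ht))
        (is_derive_minus (V := R_NormedModule) _ _ _ _ _ (Du 1%nat x Hx)
           (is_derive_flat_profile' a b c1 x))).
      apply Rminus_diag_uniq in Hu2.
      assert (Hv1 : forall t, J t -> Derive_n v 1 t = a).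
      { intros t Ht; apply Rminus_diag_uniq.
        apply (is_derive_zero_on_open J (fun t => v t - a * t - b) t); auto.
        - intros s Hs; rewrite Hv by auto; ring.
        - auto_derive; [exists (Derive_n v 1 t); exact (Dv 0%nat t Ht)|].
          change (Derive (fun s : R => v s) t) with (Derive_n v 1 t); ring. }
      assert (Hv2 : Derive_n v 2 y = 0).
      { apply (is_derive_zero_on_open J (fun t => Derive_n v 1 t - a) y); auto.
        - intros s Hs; rewrite Hv1 by auto; ring.
        - auto_derive; [exists (Derive_n v 2 y); exact (Dv 1%nat y Hy)|].
          change (Derive (fun r : R => Derive (fun s : R => v s) r) y) with (Derive_n v 2 y).
          ring. }
      rewrite Hu2, Hv2, (Hv1 y Hy), (Hu1 x Hx), (Hv y Hy).
      assert (HT := flat_radicand_pos a b x); assert (HS := sqrt_lt_R0 _ HT).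
      assert (HSS : sqrt (4 * (1 + a ^ 2) + (2 * x + b) ^ 2) ^ 2
                    = 4 * (1 + a ^ 2) + (2 * x + b) ^ 2) by (apply pow2_sqrt; lra).
      assert (Hap := pow2_ge_0 a).
      unfold flat_profile'.
      set (S := sqrt (4 * (1 + a ^ 2) + (2 * x + b) ^ 2)) in *; clearbody S.
      (* The particular solution cancels; what remains is the homogeneous part, proportional to the
         radicand minus [S^2]. *)
      transitivity (c1 * (2 * x + b) / (2 * S) * ((4 * (1 + a ^ 2) + (2 * x + b) ^ 2) - S ^ 2));
        [field; lra | rewrite HSS; ring].
Qed.
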